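(* Let $w$ be a double occurrence word in ascending order, let $\nu\ge 2$, and let $\mathcal{I}_1(\nu,k_1,\ell_1)$ and $\mathcal{I}_2(\nu,k_2,\ell_2)$ be two insertions into $w$ with $(k_1,\ell_1)\ne(k_2,\ell_2)$. If $w\star\mathcal{I}_1(\nu,k_1,\ell_1)\sim w\star\mathcal{I}_2(\nu,k_2,\ell_2)$, then either both $\mathcal{I}_1,\mathcal{I}_2$ are repeat insertions or both are return insertions.
   Context: Alphabet $\Sigma=\mathbb{N}$; words are finite sequences over $\Sigma$, $|w|$ is length, $w^R$ the reverse. A double occurrence word (DOW) is a word in which every symbol occurs either zero or exactly two times. An equivalence map is a morphism of $\Sigma^*$ induced by a bijection $\Sigma\to\Sigma$; $x\sim y$ means $f(x)=y$ for some equivalence map $f$. A word is in ascending order if it is empty or its first symbol is $1$ and the first occurrence of each symbol is one greater than the largest symbol preceding it. Insertions: let $w$ be a DOW in ascending order, $M$ its largest symbol ($M=0$ if $w$ is empty), $\nu\ge1$, and $u=(M+1)(M+2)\cdots(M+\nu)$. For integers $1\le k\le\ell\le|w|+1$ write $w=y_1y_2y_3$ with $|y_1|=k-1$, $|y_1y_2|=\ell-1$. The repeat insertion gives $w\star\rho(\nu,k,\ell)=y_1uy_2uy_3$ and the return insertion gives $w\star\tau(\nu,k,\ell)=y_1uy_2u^Ry_3$. $\mathcal{I}(\nu,k,\ell)$ denotes an insertion of either kind. *)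

(* Defs.v *)
From mathcomp Require Import all_boot.

Set Implicit Arguments.
Unset Strict Implicit.
Unset Printing Implicit Defensive.

Definition word := seq nat.

Definition double_occurrence (w : word) : Prop :=
  forall a : nat, count_mem a w = 0 \/ count_mem a w = 2.

(* The morphism of words induced by a map f on symbols is [map f]. *)
Definition word_equiv (x y : word) : Prop :=
  exists2 f : nat -> nat, bijective f & map f x = y.

(* This is 0 on the empty word. *)
Definition max_symbol (w : word) : nat := \max_(a <- w) a.

(* [index a w] is the 0-based position of the first occurrence of [a], so
   [take (index a w) w] is the part of [w] preceding it. The condition on first
   occurrences concerns symbols other than the first one of [w]. *)
Definition ascending (w : word) : Prop :=
  w = [::] \/
  (head 0 w = 1 /\
   forall a : nat, a \in w -> 0 < index a w ->
     a = (max_symbol (take (index a w) w)).+1).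

Definition new_symbols (w : word) (nu : nat) : word :=
  iota (max_symbol w).+1 nu.

(* Positions are 1-based: w = y1 y2 y3 with |y1| = k - 1 and
   |y1 y2| = l - 1, meaningful when 1 <= k <= l <= |w| + 1. *)
Definition factor1 (w : word) (k : nat) : word := take k.-1 w.
Definition factor2 (w : word) (k l : nat) : word := drop k.-1 (take l.-1 w).
Definition factor3 (w : word) (l : nat) : word := drop l.-1 w.

Inductive insertion_kind := Repeat | Return.

(* The second inserted factor: u for a repeat, the reverse of u for a return. *)
Definition second_copy (t : insertion_kind) (u : word) : word :=
  match t with Repeat => u | Return => rev u end.

Definition insertion (t : insertion_kind) (w : word) (nu k l : nat) : word :=
  let u := new_symbols w nu in
  factor1 w k ++ u ++ factor2 w k l ++ second_copy t u ++ factor3 w l.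

(* Main.v *)
(** Two invariants of a word up to renaming of symbols separate repeat from
    return insertions. First, inserting two factors of length [nu] moves every
    old symbol by multiples of [nu], so the multiset of the residues mod [nu] of
    the sums of the positions of the symbols determines the residues of the new
    symbols. These are all equal for a return insertion, but form an arithmetic
    progression of difference 2 for a repeat insertion, which forces [nu = 2].
    Second, when [nu = 2], an old symbol is interlaced with both new symbols or
    with none, so the parity of the number of interlaced pairs changes exactly
    when the two new symbols are interlaced, i.e. for repeat insertions. *)

Require Import Defs.
From mathcomp Require Import all_boot.
From mathcomp Require Import zify.

(** * Position sums of symbols *)

(* Sum of the 0-based positions at which [a] occurs. *)
Fixpoint pos_sum (a : nat) (s : word) : nat :=
  if s is _ :: s' then pos_sum a s' + count_mem a s' else 0.

Lemma pos_sum_cat a s t :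
  pos_sum a (s ++ t) = pos_sum a s + size s * count_mem a t + pos_sum a t.
Proof. by elim: s => [|x s IHs] //=; rewrite IHs count_cat mulSn /=; lia. Qed.

(** Reversal sends position [i] to [size s - 1 - i]; the additive form avoids truncated
    subtraction. *)
Lemma pos_sum_rev a s :
  pos_sum a (rev s) + pos_sum a s + count_mem a s = size s * count_mem a s.
Proof.
elim: s => [|x s IHs] //=.
by rewrite rev_cons -cats1 pos_sum_cat size_rev /=; case: (x == a) IHs => /=; lia.
Qed.

Lemma pos_sum_notin (a : nat) (s : word) : a \notin s -> pos_sum a s = 0.
Proof.
elim: s => [|x s IHs] //=.
by rewrite inE negb_or => /andP[_ /[dup] /count_memPn -> /IHs ->].
Qed.

Lemma pos_sum_uniq (a : nat) (s : word) : uniq s -> a \in s -> pos_sum a s = index a s.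
Proof.
elim: s => [|x s IHs] //= /andP[xs us]; rewrite inE [x == a]eq_sym.
case: eqVneq => [-> _|_ /= ain]; first by rewrite pos_sum_notin ?(count_memPn xs).
by rewrite IHs // count_uniq_mem // ain addn1.
Qed.

Lemma pos_sum_map (f : nat -> nat) (a : nat) (s : word) :
  injective f -> pos_sum (f a) (map f s) = pos_sum a s.
Proof.
move=> inj_f; elim: s => [|x s IHs] //=; rewrite IHs count_map.
by congr (_ + _); apply: eq_count => y /=; rewrite inj_eq.
Qed.

(** * The two invariants under renaming *)

Definition residue_count (nu r : nat) (z : word) : nat :=
  count (fun a => pos_sum a z == r %[mod nu]) (undup z).

Lemma residue_count_map f nu r z :
  injective f -> residue_count nu r (map f z) = residue_count nu r z.
Proof.
move=> inj_f; rewrite /residue_count undup_map_inj // count_map.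
by apply: eq_count => a /=; rewrite pos_sum_map.
Qed.

(** The pair is ordered: in a double occurrence word at most one of [(a, b)] and [(b, a)] qualifies,
    so the double sum below counts each interlaced pair once. *)
Definition interlaced (z : word) (a b : nat) : bool := subseq [:: a; b; a; b] z.

Definition interlace_count (z : word) : nat :=
  \sum_(a <- undup z) \sum_(b <- undup z) interlaced z a b.

Lemma interlaced_map (f g : nat -> nat) z a b : cancel f g ->
  interlaced (map f z) (f a) (f b) = interlaced z a b.
Proof.
move=> fK; apply/idP/idP => [/(map_subseq g)|]; last exact: (@map_subseq _ _ f).
by rewrite (mapK fK) /= !fK.
Qed.

Lemma interlace_count_map (f g : nat -> nat) z : cancel f g ->
  interlace_count (map f z) = interlace_count z.
Proof.
move=> fK; rewrite /interlace_count undup_map_inj; last exact: can_inj fK.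
rewrite big_map; apply: eq_bigr => a _; rewrite big_map.
by apply: eq_bigr => b _; rewrite (interlaced_map _ _ _ _ _ fK).
Qed.

Lemma interlaced_filter (P : pred nat) z a b : P a -> P b ->
  interlaced (filter P z) a b = interlaced z a b.
Proof. by move=> Pa Pb; rewrite /interlaced subseq_filter /= Pa Pb. Qed.

(** * Residues of position sums after an insertion *)

Definition insert (t : insertion_kind) (u y1 y2 y3 : word) : word :=
  y1 ++ u ++ y2 ++ second_copy t u ++ y3.

Lemma size_second_copy t u : size (second_copy t u) = size u.
Proof. by case: t; rewrite //= size_rev. Qed.

Lemma mem_second_copy t u : second_copy t u =i u.
Proof. by case: t => a; rewrite //= mem_rev. Qed.

Lemma disjoint_notin (w u : word) (a : nat) :
  ~~ has (mem w) u -> a \in w -> a \notin u.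
Proof. by move=> uw aw; apply: contra uw => au; apply/hasP; exists a. Qed.

Lemma disjoint_notin_old (w u : word) (a : nat) :
  ~~ has (mem w) u -> a \in u -> a \notin w.
Proof. by move=> uw au; apply: contra uw => aw; apply/hasP; exists a. Qed.

Lemma perm_undup_insert t (u y1 y2 y3 : word) (w := y1 ++ y2 ++ y3) :
  uniq u -> ~~ has (mem w) u ->
  perm_eq (undup (insert t u y1 y2 y3)) (undup w ++ u).
Proof.
move=> uu uw; apply: uniq_perm; rewrite ?undup_uniq //.
  rewrite cat_uniq undup_uniq uu andbT /=.
  by apply: contra uw => /hasP[x xu]; rewrite /= mem_undup => ?; apply/hasP; exists x.
move=> x; rewrite mem_undup /insert !mem_cat mem_undup !mem_cat mem_second_copy.
by do !case: (x \in _).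
Qed.

Lemma pos_sum_insert_old t (u y1 y2 y3 : word) (a : nat) : a \notin u ->
  pos_sum a (insert t u y1 y2 y3) = pos_sum a (y1 ++ y2 ++ y3) %[mod size u].
Proof.
move=> au; have av : a \notin second_copy t u by rewrite mem_second_copy.
rewrite /insert !pos_sum_cat !count_cat size_second_copy.
rewrite (count_memPn au) (count_memPn av).
rewrite (pos_sum_notin _ _ au) (pos_sum_notin _ _ av).
(* An occurrence in [y2] moves right by [size u], one in [y3] by twice that. *)
rewrite -[RHS](modnMDl (count_mem a y2 + count_mem a y3 + count_mem a y3)).
by congr (_ %% _); rewrite /=; lia.
Qed.

(** For a return the two index terms add up to [size u - 1], so all new symbols share one sum; for a
    repeat the sum grows by 2 from each symbol of [u] to the next. *)
Lemma pos_sum_insert_new t (u y1 y2 y3 : word) (a : nat) :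
  uniq u -> a \in u -> a \notin y1 ++ y2 ++ y3 ->
  pos_sum a (insert t u y1 y2 y3) =
    size y1 + index a u + (size y1 + size u + size y2) +
    (if t is Repeat then index a u else size u - (index a u).+1).
Proof.
move=> uu au; rewrite !mem_cat !negb_or => /and3P[a1 a2 a3].
rewrite /insert !pos_sum_cat !count_cat (count_memPn a2) (count_memPn a3).
rewrite (pos_sum_notin _ _ a1) (pos_sum_notin _ _ a2) (pos_sum_notin _ _ a3).
have c1 : count_mem a u = 1 by rewrite count_uniq_mem ?au.
have pu := pos_sum_uniq a u uu au.
have := index_mem a u; rewrite au => iu.
case: t => /=; first by rewrite c1 pu; lia.
by have := pos_sum_rev a u; rewrite count_rev c1 pu; lia.
Qed.

(** Old symbols keep their residues, so their contribution depends on [w] alone and cancels when two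
    insertions into [w] are compared. *)
Lemma residue_count_insert t (u y1 y2 y3 : word) r (w := y1 ++ y2 ++ y3)
    (z := insert t u y1 y2 y3) :
  uniq u -> ~~ has (mem w) u ->
  residue_count (size u) r z = residue_count (size u) r w +
    count (fun a => pos_sum a z == r %[mod size u]) u.
Proof.
move=> uu uw; rewrite /residue_count.
rewrite (permP (perm_undup_insert t u y1 y2 y3 uu uw)) count_cat; congr (_ + _).
apply: eq_in_count => a; rewrite mem_undup => aw.
by rewrite pos_sum_insert_old // (disjoint_notin w).
Qed.

Lemma size_repeat_return (u w y1 y2 y3 x1 x2 x3 : word) f :
  uniq u -> ~~ has (mem w) u -> 1 < size u ->
  y1 ++ y2 ++ y3 = w -> x1 ++ x2 ++ x3 = w -> injective f ->
  map f (insert Repeat u y1 y2 y3) = insert Return u x1 x2 x3 -> size u = 2.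
Proof.
move=> uu uw nu_gt1 wy wx inj_f eq_z.
(* The common position sum of the new symbols in the return insertion. *)
set B := 2 * size x1 + 2 * size u + size x2 - 1.
have new_return (a : nat) : a \in u -> pos_sum a (insert Return u x1 x2 x3) = B.
  move=> au; rewrite pos_sum_insert_new ?wx ?(disjoint_notin_old w u) //.
  by have := index_mem a u; rewrite au /B /=; lia.
have: residue_count (size u) B (insert Repeat u y1 y2 y3) =
      residue_count (size u) B (insert Return u x1 x2 x3).
  by rewrite -eq_z residue_count_map.
rewrite !residue_count_insert ?wy ?wx // => /addnI.
have -> : count (fun a => pos_sum a (insert Return u x1 x2 x3) == B
                   %[mod size u]) u = size u.
  by apply/eqP; rewrite -all_count; apply/allP => a au; rewrite new_return.
move/eqP; rewrite -all_count => /allP all_B.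
have new_repeat i : i < size u ->
    2 * i + (2 * size y1 + size u + size y2) = B %[mod size u].
  move=> i_lt; have au : nth 0 u i \in u by rewrite mem_nth.
  have := all_B _ au; rewrite pos_sum_insert_new ?wy ?(disjoint_notin_old w u) //.
  by rewrite index_uniq // => /eqP <-; congr (_ %% _); lia.
(* Comparing the first two symbols of [u] gives 2 = 0 modulo [size u], so [size u] divides 2. *)
have /eqP := etrans (new_repeat 1 nu_gt1) (esym (new_repeat 0 (ltnW nu_gt1))).
by rewrite eqn_modDr mod0n => /dvdn_leq; lia.
Qed.

(** * Parity of interlaced pairs after inserting two symbols *)

Section TwoNewSymbols.

Variables (p q : nat) (w y1 y2 y3 : word) (t : insertion_kind).
Hypotheses (pq : p != q) (pw : p \notin w) (qw : q \notin w).
Hypothesis wE : y1 ++ y2 ++ y3 = w.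

Let z := insert t [:: p; q] y1 y2 y3.

Let filter_old (P : pred nat) (y : word) :
  {subset y <= w} -> {in w, forall x, P x} -> filter P y = y.
Proof. by move=> yw Pw; apply/all_filterP/allP => x /yw /Pw. Qed.

Let sub1 : {subset y1 <= w}.
Proof. by move=> x; rewrite -wE !mem_cat => ->. Qed.
Let sub2 : {subset y2 <= w}.
Proof. by move=> x; rewrite -wE !mem_cat => ->; rewrite orbT. Qed.
Let sub3 : {subset y3 <= w}.
Proof. by move=> x; rewrite -wE !mem_cat => ->; rewrite !orbT. Qed.

Let neq_p (a : nat) : a \in w -> a != p.
Proof. by move=> aw; apply: contraNneq pw => <-. Qed.
Let neq_q (a : nat) : a \in w -> a != q.
Proof. by move=> aw; apply: contraNneq qw => <-. Qed.

Let swap (x : nat) : nat := if x == p then q else if x == q then p else x.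

Let swapK : involutive swap.
Proof.
move=> x; rewrite /swap; case: (eqVneq x p) => [->|xp].
  by rewrite [q == p]eq_sym (negbTE pq) eqxx.
by case: (eqVneq x q) => [->|xq]; rewrite ?eqxx // (negbTE xp) (negbTE xq).
Qed.

Let swap_old (a : nat) : a \in w -> swap a = a.
Proof. by move=> aw; rewrite /swap (negbTE (neq_p _ aw)) (negbTE (neq_q _ aw)). Qed.

Let filter_insert (P : pred nat) : {in w, forall x, P x} ->
  filter P z = y1 ++ filter P [:: p; q] ++ y2 ++
               second_copy t (filter P [:: p; q]) ++ y3.
Proof.
move=> Pw; rewrite /z /insert !filter_cat.
rewrite (filter_old P y1) // (filter_old P y2) // (filter_old P y3) //.
by case: t; rewrite /second_copy ?filter_rev.
Qed.

Let interlaced_old (a b : nat) : a \in w -> b \in w ->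
  interlaced z a b = interlaced w a b.
Proof.
pose P := [pred x | (x != p) && (x != q)].
have Pw : {in w, forall x, P x} by move=> x xw /=; rewrite neq_p ?neq_q.
move=> aw bw; rewrite -(interlaced_filter P) ?Pw // filter_insert //= !eqxx andbF /=.
by case: t; rewrite /= wE.
Qed.

(* Erasing one of the two new symbols leaves the same word up to renaming. *)
Let swap_filter : filter (predC1 p) z = map swap (filter (predC1 q) z).
Proof.
rewrite (filter_insert (predC1 p) neq_p) (filter_insert (predC1 q) neq_q).
rewrite /= !eqxx pq [q == p]eq_sym (negbTE pq) /=.
have mapE y : {subset y <= w} -> map swap y = y.
  by move=> yw; apply: map_id_in => x /yw /swap_old.
have swp : swap p = q by rewrite /swap eqxx.
by case: t; rewrite /= !(map_cat, map_cons) /= !mapE // swp.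
Qed.

(** Interlacing survives the erasure of a third symbol. Erasing [q] or erasing [p] gives words
    exchanged by [swap], which fixes [a]. *)
Let interlaced_mixed (a : nat) : a \in w ->
  interlaced z a p = interlaced z a q /\ interlaced z p a = interlaced z q a.
Proof.
move=> aw; have [ap aq] := (neq_p _ aw, neq_q _ aw).
have swp : swap p = q by rewrite /swap eqxx.
have qp : q != p by rewrite eq_sym.
split.
  rewrite -(interlaced_filter (predC1 q) z a p) //.
  rewrite -(interlaced_filter (predC1 p) z a q) //.
  by rewrite -[LHS](interlaced_map _ _ _ _ _ swapK) -swap_filter swp swap_old.
rewrite -(interlaced_filter (predC1 q) z p a) //.
rewrite -(interlaced_filter (predC1 p) z q a) //.
by rewrite -[LHS](interlaced_map _ _ _ _ _ swapK) -swap_filter swp swap_old.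
Qed.

(** Erasing all old symbols leaves only the two inserted copies. *)
Let interlaced_new (a b : nat) : a \in [:: p; q] -> b \in [:: p; q] ->
  interlaced z a b = interlaced ([:: p; q] ++ second_copy t [:: p; q]) a b.
Proof.
move=> au bu; rewrite -(interlaced_filter (mem [:: p; q])) //.
have filter0 (y : word) : {subset y <= w} -> filter (mem [:: p; q]) y = [::].
  move=> yw; apply/eqP; rewrite -(negbK (_ == _)) -has_filter; apply/hasPn=> x /yw xw.
  by rewrite /= !inE (negbTE (neq_p _ xw)) (negbTE (neq_q _ xw)).
rewrite /z /insert !filter_cat (filter0 y1) // (filter0 y2) // (filter0 y3) //.
by case: t; rewrite /= /rev /= !inE !eqxx orbT.
Qed.

(** The double sum splits into old and new blocks. The old block is that of [w], the mixed blocks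
    are even, and in the new block only [(p, q)] can count, in the pattern [pqpq] of a repeat. *)
Lemma odd_interlace_count_insert :
  odd (interlace_count z) =
  odd (interlace_count w) (+) (if t is Repeat then true else false).
Proof.
have uu : uniq [:: p; q] by rewrite /= inE pq.
have uw : ~~ has (mem (y1 ++ y2 ++ y3)) [:: p; q].
  by rewrite wE /= orbF negb_or pw qw.
have pz := perm_undup_insert t _ _ _ _ uu uw.
rewrite /interlace_count (perm_big _ pz) /= big_cat /=.
under eq_bigr => a _ do rewrite (perm_big _ pz) big_cat /=.
rewrite wE !big_cons big_nil !(perm_big _ pz) /= wE !big_cat !big_cons !big_nil.
rewrite big_split /=.
rewrite (eq_big_seq (fun a => \sum_(b <- undup w) interlaced w a b)); last first.
  move=> a; rewrite mem_undup => aw; apply: eq_big_seq => b; rewrite mem_undup => bw.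
  by rewrite interlaced_old.
rewrite [X in _ + X + _](eq_big_seq (fun a => interlaced z a q * 2)); last first.
  move=> a; rewrite mem_undup => aw; rewrite !big_cons big_nil.
  by rewrite (proj1 (interlaced_mixed _ aw)) addn0 addnn muln2.
rewrite [\sum_(j <- undup w) interlaced z p j]
  (eq_big_seq (fun a => interlaced z q a : nat)); last first.
  by move=> a; rewrite mem_undup => aw; rewrite (proj2 (interlaced_mixed _ aw)).
rewrite -big_distrl /=.
have [pu qu] : p \in [:: p; q] /\ q \in [:: p; q] by rewrite !inE !eqxx orbT.
have qp : (q == p) = false by rewrite eq_sym (negbTE pq).
have -> : interlaced z p q = (if t is Repeat then true else false).
  rewrite interlaced_new // /interlaced.
  by case: t; do 4?rewrite /= ?eqxx ?qp ?(negbTE pq).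
have [-> -> ->] : [/\ interlaced z p p = false, interlaced z q p = false
                    & interlaced z q q = false].
  rewrite !interlaced_new // /interlaced.
  by case: t; do 4?rewrite /= ?eqxx ?qp ?(negbTE pq).
rewrite !oddD oddM andbF addbF oddb /=.
(* The sum for [q] occurs twice, once in place of the sum for [p], so its parity cancels. *)
case: (odd (\sum_(i <- undup w) interlaced z q i)); case: (t) => //=.
all: by rewrite ?addbF ?addbT ?negbK.
Qed.

End TwoNewSymbols.

(** * Incompatibility of repeat and return insertions *)

Lemma insert_repeat_return (u w y1 y2 y3 x1 x2 x3 : word) f g :
  uniq u -> ~~ has (mem w) u -> 1 < size u ->
  y1 ++ y2 ++ y3 = w -> x1 ++ x2 ++ x3 = w -> cancel f g ->
  map f (insert Repeat u y1 y2 y3) <> insert Return u x1 x2 x3.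
Proof.
move=> uu uw nu_gt1 wy wx fK eq_z.
have := size_repeat_return _ _ _ _ _ _ _ _ _ uu uw nu_gt1 wy wx (can_inj fK) eq_z.
(* The residues have forced [u] to be a two-letter word [pq]; the parities of the interlace counts
   then differ. *)
case: u uu uw eq_z {nu_gt1} => [|p [|q []]] //=.
rewrite inE andbT orbF negb_or => pq /andP[pw qw] eq_z _.
have := odd_interlace_count_insert p q w y1 y2 y3 Repeat pq pw qw wy.
rewrite -(interlace_count_map f g _ fK) eq_z.
rewrite (odd_interlace_count_insert p q w x1 x2 x3 Return pq pw qw wx).
by case: (odd _).
Qed.

Lemma new_symbols_disjoint (w : word) nu : ~~ has (mem w) (new_symbols w nu).
Proof.
apply/hasPn => a; rewrite mem_iota => /andP[a_gt _]; apply/negP => /= aw.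
by have := leq_bigmax_seq a (F := id) aw isT; rewrite leqNgt a_gt.
Qed.

Lemma cat_factors w k l : k <= l ->
  factor1 w k ++ factor2 w k l ++ factor3 w l = w.
Proof.
move=> kl; rewrite /factor1 /factor2 /factor3 catA.
rewrite -[X in X ++ _](_ : take l.-1 w = _) ?cat_take_drop //.
have kl' : k.-1 <= l.-1 by lia.
by rewrite -{1}(cat_take_drop k.-1 (take l.-1 w)) take_takel.
Qed.

Lemma insertion_repeat_return w nu k l k' l' : 1 < nu -> k <= l -> k' <= l' ->
  ~ word_equiv (insertion Repeat w nu k l) (insertion Return w nu k' l').
Proof.
move=> nu_gt1 kl kl' [f [g fK _] eq_z].
apply: (insert_repeat_return (new_symbols w nu) w _ _ _ _ _ _ f g _ _ _
  (cat_factors w k l kl) (cat_factors w k' l' kl') fK eq_z).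
- exact: iota_uniq.
- exact: new_symbols_disjoint.
- by rewrite size_iota.
Qed.

Lemma word_equiv_sym x y : word_equiv x y -> word_equiv y x.
Proof.
by case=> f [g fK gK] <-; exists g; [exists f | rewrite (mapK fK)].
Qed.

Theorem theorem3p17 (w : word) (nu : nat) (I1 I2 : insertion_kind)
    (k1 l1 k2 l2 : nat)
    (w_dow : double_occurrence w) (w_asc : ascending w)
    (nu_ge2 : 2 <= nu)
    (kl1 : 1 <= k1 <= l1 /\ l1 <= size w + 1)
    (kl2 : 1 <= k2 <= l2 /\ l2 <= size w + 1)
    (kl_neq : (k1, l1) <> (k2, l2))
    (equiv12 : word_equiv (insertion I1 w nu k1 l1) (insertion I2 w nu k2 l2)) :
  (I1 = Repeat /\ I2 = Repeat) \/ (I1 = Return /\ I2 = Return).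
Proof.
case: kl1 => /andP[_ kl1] _; case: kl2 => /andP[_ kl2] _.
case: I1 I2 equiv12 => [] [] equiv12; [by left| | |by right].
  by case: (insertion_repeat_return w nu k1 l1 k2 l2).
(* The inverse renaming reduces this case to a repeat renamed into a return. *)
by case: (insertion_repeat_return w nu k2 l2 k1 l1) => //; apply: word_equiv_sym.
Qed.
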